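(* Let $r,s\ge 0$ be integers, let $d=r+2s$, and let $A\in\mathbb{R}^{d\times d}$ be a symmetric matrix. Let $J_s=\mathrm{Id}_{r+s}\oplus(-\mathrm{Id}_s)\in\mathbb{R}^{d\times d}$. Then the polynomial $$p(x)=\det(xJ_s-A)\in\mathbb{R}[x]$$ has at least $r$ real roots counted with multiplicity.
   Context: $\mathrm{Id}_k$ is the $k\times k$ identity matrix and $\oplus$ denotes the usual (block diagonal) direct sum of matrices. *)

(* Defs.v *)
From mathcomp Require Import all_boot all_order all_algebra.
From mathcomp Require Import polyorder polyrcf.
From mathcomp Require Import reals.

Set Implicit Arguments.
Unset Strict Implicit.
Unset Printing Implicit Defensive.
Import Order.TTheory GRing.Theory Num.Theory.
Local Open Scope ring_scope.

(* The dimension d = r + 2s is written r + s + s so that the direct sum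
   Id_(r+s) (+) (-Id_s) is literally a block matrix. *)
Definition Jmx (R : realType) (r s : nat) : 'M[R]_(r + s + s) :=
  block_mx 1%:M 0 0 (- 1%:M).

(* det (x J - A), computed over R[x]. *)
Definition det_pencil (R : realType) (d : nat) (J A : 'M[R]_d) : {poly R} :=
  \det ('X *: map_mx polyC J - map_mx polyC A).

(* rootsR p lists the distinct real roots of p. Since rootsR 0 = [::], the
   count of the zero polynomial is 0, so a positive lower bound on the count
   is never satisfied by p = 0. *)
Definition nb_real_roots (R : realType) (p : {poly R}) : nat :=
  (\sum_(x <- rootsR p) \mu_x p)%N.

(* Main.v *)
Require Import Defs.
From mathcomp Require Import all_boot all_order all_algebra.
From mathcomp Require Import polyorder polyrcf complex.
From mathcomp Require Import reals.
Import Order.TTheory GRing.Theory Num.Theory.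
Set Implicit Arguments.
Unset Strict Implicit.
Unset Printing Implicit Defensive.
Local Open Scope ring_scope.

(** Let J = Jmx R r s and M = A J. As J^2 = 1, det (x J - A) is the
    characteristic polynomial of M times the nonzero constant det J, so the
    task is to bound the number of non-real eigenvalues of M by 2 s. Write
    adj for the conjugate transpose. Over the complex numbers J and A are
    Hermitian, so M is self-adjoint, as a map u |-> u M on row vectors, for
    the Hermitian form u J adj(v), which has signature (r + s, s).

    Let Z be a list of roots of the characteristic polynomial, taken with at
    most their multiplicities, no two of them (nor one with itself) conjugate.
    There is a space W of dimension |Z|, invariant under M, on which M acts by
    a matrix N whose eigenvalues are Z ([invariant_subspace]). Self-adjointness
    says that the Gram matrix G = W J adj(W) satisfies N G = G adj(N); since N
    and adj(N) have no common eigenvalue, G = 0 ([sylvester_eq0]). So W is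
    isotropic, and an isotropic space for a form with s negative squares has
    dimension at most s ([isotropic_dim]).

    Applied to the roots in the open upper half-plane, and then to those in
    the open lower one, this leaves at least (r + 2 s) - 2 s = r real roots
    ([count_nonreal_roots]). *)

Lemma char_poly_intertwine (F : fieldType) n (P M T : 'M[F]_n) :
  P \in unitmx -> P *m M = T *m P -> char_poly M = char_poly T.
Proof.
move=> Pu PM; have detP : \det (map_mx polyC P) != 0.
  by rewrite det_map_mx polyC_eq0 -unitfE.
apply: (mulfI detP); rewrite [RHS]mulrC -!det_mulmx; congr (\det _).
rewrite /char_poly_mx mulmxBr mulmxBl -!map_mxM PM; congr (_ - _).
exact: scalar_mxC.
Qed.

(** Put an eigenvector for z first in a basis, the rest being arbitrary: this is
    one step of triangularization, with an eigenvalue of one's choice. The basis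
    is the extended row basis of the eigenvector v, whose first row is a nonzero
    multiple of v. *)
Lemma eigenvector_block (F : fieldType) n (M : 'M[F]_(1 + n)) z :
  root (char_poly M) z ->
  exists P : 'M_(1 + n), exists B : 'M_(n, 1), exists C : 'M_n,
    P \in unitmx /\ P *m M = block_mx z%:M 0 B C *m P.
Proof.
rewrite -eigenvalue_root_char => /eigenvalueP[v vM v0].
have Pu := row_ebase_unit v; set P := row_ebase v in Pu.
have vE : v = col_ebase v *m usubmx P.
  rewrite -{1}(mulmx_ebase v) rank_rV v0 -mulmxA; congr (_ *m _).
  have -> : pid_mx 1 = row_mx 1%:M 0 :> 'M[F]_(1, 1 + n).
    by rewrite pid_mx_row.
  by rewrite -[row_ebase v]vsubmxK mul_row_col mul1mx mul0mx addr0.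
have uE : usubmx P = invmx (col_ebase v) *m v.
  by rewrite {2}vE mulKmx ?col_ebase_unit.
have uM : usubmx P *m M = z *: usubmx P.
  by rewrite uE -mulmxA vM scalemxAr.
pose T := dsubmx P *m M *m invmx P.
exists P, (lsubmx T), (rsubmx T); split=> //.
rewrite -{1 2}(vsubmxK P) mul_col_mx mul_block_col uM.
rewrite mul_scalar_mx mul0mx addr0; congr col_mx.
by rewrite -mul_row_col hsubmxK vsubmxK mulmxKV.
Qed.

(** Triangularization with the eigenvalues in a prescribed order, stopped once
    the list s is exhausted. The quotient by the eigenvector for the head of s
    has the remaining roots in its characteristic polynomial, and the invariant
    subspace found there is pulled back. Since s may have repetitions, this covers
    roots with multiplicity. *)
Lemma invariant_subspace (F : fieldType) (s : seq F) n (M : 'M[F]_n) :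
    \prod_(z <- s) ('X - z%:P) %| char_poly M ->
  exists W : 'M_(size s, n), exists N : 'M_(size s),
    [/\ row_free W, W *m M = N *m W
      & char_poly N = \prod_(z <- s) ('X - z%:P)].
Proof.
elim: s n M => [|z s IHs] n M.
  move=> _; exists 0, 0; split; first by rewrite /row_free mxrank0.
    by rewrite !mul0mx.
  by rewrite big_nil /char_poly det_mx00.
rewrite big_cons => dvd_s; case: n M dvd_s => [|n] M.
  rewrite /char_poly det_mx00 dvdp1 => /eqP /(congr1 predn).
  rewrite size_mul ?polyXsubC_eq0 ?size_XsubC //=.
    by rewrite size_prod_XsubC.
  by rewrite -size_poly_eq0 size_prod_XsubC.
move: M; rewrite -[n.+1]/(1 + n)%N => M dvd_s.
have /eigenvector_block[P [B [C [Pu PM]]]] : root (char_poly M) z.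
  rewrite -dvdp_XsubCl; exact: dvdp_trans (dvdp_mulr _ _) dvd_s.
have char_block k (B' : 'M_(k, 1)) (C' : 'M_k) :
    char_poly (block_mx z%:M 0 B' C') = ('X - z%:P) * char_poly C'.
  rewrite /char_poly /char_poly_mx map_block_mx.
  rewrite (scalar_mx_block 1 k) opp_block_mx add_block_mx map_mx0 oppr0 addr0.
  by rewrite det_lblock map_scalar_mx -raddfB det_scalar1.
move: dvd_s; rewrite (char_poly_intertwine Pu PM) char_block.
rewrite dvdp_mul2l ?polyXsubC_eq0 // => /IHs[W [N [freeW WC charN]]].
rewrite -[size (z :: s)]/(1 + size s)%N.
exists (block_mx 1%:M 0 0 W *m P), (block_mx z%:M 0 (W *m B) N); split.
- rewrite /row_free mxrankMfree ?row_free_unit // rank_diag_block_mx.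
  by rewrite mxrank1 (eqP freeW).
- rewrite -mulmxA PM !mulmxA !mulmx_block WC.
  by rewrite ?(mul1mx, mulmx1, mul0mx, mulmx0, addr0, add0r).
- by rewrite char_block charN.
Qed.

(** For every polynomial p, p(N) G = G p(N'). If
    u * char_poly N + v * char_poly N' = 1, evaluating at N' on the right of G gives G: the second term vanishes by
    Cayley-Hamilton for N', the first one, moved to the left of G, by
    Cayley-Hamilton for N. *)
Lemma sylvester_eq0 (F : fieldType) m n (N : 'M[F]_m) (N' : 'M[F]_n)
    (G : 'M_(m, n)) :
  coprimep (char_poly N) (char_poly N') -> N *m G = G *m N' -> G = 0.
Proof.
case: m n N N' G => [|m] [|n] N N' G; rewrite ?flatmx0 ?thinmx0 //.
move=> /Bezout_eq1_coprimepP[[u v] /= uv] NG.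
have hornerG p : horner_mx N p *m G = G *m horner_mx N' p.
  elim/poly_ind: p => [|p c IHp]; first by rewrite !rmorph0 mul0mx mulmx0.
  rewrite !rmorphD !rmorphM /= !horner_mx_X !horner_mx_C mulmxDl mulmxDr.
  by rewrite -!mulmxE -mulmxA NG !mulmxA IHp scalar_mxC.
have -> : G = G *m horner_mx N' (u * char_poly N + v * char_poly N').
  by rewrite uv rmorph1 mulmx1.
rewrite rmorphD (rmorphM _ v) /= Cayley_Hamilton mulr0 addr0 -hornerG.
by rewrite rmorphM /= Cayley_Hamilton mulr0 mul0mx.
Qed.

(** [Jmx R r s] is [signature_mx R (r + s) s] by conversion; the base ring
    is arbitrary so that the matrix can be moved from the reals to the
    complexes. *)
Definition signature_mx (R : nzRingType) (p q : nat) : 'M[R]_(p + q) :=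
  block_mx 1%:M 0 0 (- 1%:M).

Lemma signature_mx_sqr (R : nzRingType) p q :
  signature_mx R p q *m signature_mx R p q = 1%:M.
Proof.
rewrite mulmx_block !(mul1mx, mulmx1, mulmx0, mul0mx, addr0, add0r).
by rewrite mulNmx mulmxN opprK mulmx1 -scalar_mx_block.
Qed.

Lemma map_signature_mx (R S : nzRingType) (f : {rmorphism R -> S}) p q :
  map_mx f (signature_mx R p q) = signature_mx S p q.
Proof. by rewrite map_block_mx !map_mx0 map_mxN !map_mx1. Qed.

Lemma tr_signature_mx (R : nzRingType) p q :
  (signature_mx R p q)^T = signature_mx R p q.
Proof. by rewrite tr_block_mx !trmx0 linearN /= !tr_scalar_mx. Qed.

Local Notation adjmx A := (map_mx Num.conj A^T).

Section Signature.
Variable C : numClosedFieldType.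

Lemma char_poly_adjmx m (N : 'M[C]_m) :
  char_poly (adjmx N) = map_poly Num.conj (char_poly N).
Proof.
rewrite map_char_poly -map_trmx /char_poly -det_tr; congr (\det _).
by rewrite /char_poly_mx raddfB /= tr_scalar_mx -!map_trmx trmxK.
Qed.

Lemma mulmx_adj_eq0 m n (X : 'M[C]_(m, n)) : X *m adjmx X = 0 -> X = 0.
Proof.
move=> XX0; apply/matrixP=> i j; have /matrixP/(_ i i) := XX0.
rewrite !mxE => /psumr_eq0P XX_ij; apply/eqP.
have /eqP : X i j * (adjmx X) j i = 0.
  by apply: XX_ij => // k _; rewrite !mxE -normCK exprn_ge0.
by rewrite !mxE -normCK expf_eq0 normr_eq0.
Qed.

(** With W = [U V], isotropy reads U adj(U) = V adj(V). A linear
    combination of rows that kills V then kills U, hence W; as W is row free,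
    so is V, which has only q columns. *)
Lemma isotropic_dim m p q (W : 'M[C]_(m, p + q)) :
  row_free W -> W *m signature_mx C p q *m adjmx W = 0 -> (m <= q)%N.
Proof.
move=> freeW; rewrite -(hsubmxK W); set U := lsubmx W; set V := rsubmx W.
rewrite mul_row_block tr_row_mx map_col_mx mul_row_col.
rewrite !(mulmx1, mulmx0, addr0, add0r) mulmxN mulmx1 mulNmx => /subr0_eq UV.
suff /eqP <- : row_free V by exact: rank_leq_col.
rewrite -kermx_eq0; set K := kermx V.
have KV : K *m V = 0 by exact: mulmx_ker.
have KU : K *m U = 0.
  apply: mulmx_adj_eq0.
  by rewrite trmx_mul map_mxM mulmxA -(mulmxA K) UV mulmxA KV !mul0mx.
have KW : K *m W = 0 by rewrite -(hsubmxK W) mul_mx_row KU KV row_mx0.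
by apply/eqP/(row_free_inj freeW); rewrite KW mul0mx.
Qed.

(** The case z = w of the last hypothesis excludes the real numbers from s. *)
Lemma nonconjugate_roots_bound p q (A : 'M[C]_(p + q)) (s : seq C) :
    adjmx A = A ->
    \prod_(z <- s) ('X - z%:P) %| char_poly (A *m signature_mx C p q) ->
    (forall z w, z \in s -> w \in s -> z != w^*) ->
  (size s <= q)%N.
Proof.
move=> hermA /invariant_subspace[W [N [freeW WN charN]]] sconj.
(* It remains to show that the Gram matrix of W vanishes. *)
apply: isotropic_dim freeW _.
have WA : W *m A = N *m W *m signature_mx C p q.
  by rewrite -WN -!mulmxA signature_mx_sqr mulmx1.
have WAt : A *m adjmx W = signature_mx C p q *m adjmx W *m adjmx N.
  have Jadj : adjmx (signature_mx C p q) = signature_mx C p q.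
    by rewrite tr_signature_mx map_signature_mx.
  rewrite -{1}hermA -map_mxM -trmx_mul WA !trmx_mul !map_mxM Jadj.
  by rewrite mulmxA.
apply: (@sylvester_eq0 _ _ _ N (adjmx N)); last first.
  by rewrite !mulmxA -WA -!mulmxA WAt !mulmxA.
rewrite char_poly_adjmx charN; apply/Pdiv.ClosedField.coprimepP => z.
rewrite root_prod_XsubC => sz; rewrite rmorph_prod /=.
under eq_bigr do rewrite map_polyXsubC.
rewrite horner_prod prodf_seq_neq0; apply/allP => w sw /=.
by rewrite hornerXsubC subr_eq0 sconj.
Qed.

Lemma prod_filter_dvdp (s : seq C) (P : pred C) :
  \prod_(z <- filter P s) ('X - z%:P) %| \prod_(z <- s) ('X - z%:P).
Proof. by rewrite big_filter [X in _ %| X](bigID P) dvdp_mulr. Qed.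

(** Conjugation exchanges the open upper and lower half-planes, so neither the
    roots in the first nor those in the second contain two conjugates: each of
    the two parts has at most q elements. *)
Lemma count_nonreal_roots p q (A : 'M[C]_(p + q)) (s : seq C) :
    adjmx A = A ->
    char_poly (A *m signature_mx C p q) = \prod_(z <- s) ('X - z%:P) ->
  (count (predC (mem Num.real)) s <= q + q)%N.
Proof.
move=> hermA char_s.
have bound (P : pred C) : (forall z w, P z -> P w -> z != w^*) ->
    (count P s <= q)%N.
  move=> Pconj; rewrite -size_filter; apply: nonconjugate_roots_bound hermA _ _.
    by rewrite char_s; exact: prod_filter_dvdp.
  by move=> z w; rewrite !mem_filter => /andP[Pz _] /andP[Pw _]; exact: Pconj.
have upper : (count (fun z => 0 < 'Im z)%R s <= q)%N.
  apply: bound => z w z0 w0; apply/eqP => zw; move: z0.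
  by rewrite zw Im_conj oppr_gt0 (lt_gtF w0).
have lower : (count (fun z => 'Im z < 0)%R s <= q)%N.
  apply: bound => z w z0 w0; apply/eqP => zw; move: z0.
  by rewrite zw Im_conj oppr_lt0 (lt_gtF w0).
apply: leq_trans (leq_add upper lower); rewrite -count_predUI.
apply: leq_trans (leq_addr _ _); apply: sub_count => z /= /Creal_ImP/eqP.
by rewrite real_neqr_lt ?Creal_Im ?real0 // orbC.
Qed.

End Signature.

(** The multiplicity of x in s is at most that of x as a root of p, and
    every element of s occurs in the list of roots of p. *)
Lemma dvdp_nb_real_roots (R : realType) (p : {poly R}) (s : seq R) :
  p != 0 -> \prod_(x <- s) ('X - x%:P) %| p -> (size s <= nb_real_roots p)%N.
Proof.
move=> p0 dvd_p.
have mu_ge x : (count_mem x s <= \mu_x p)%N.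
  rewrite -root_le_mu //; apply: dvdp_trans dvd_p.
  rewrite (bigID (pred1 x)) /=; apply: dvdp_mulr.
  rewrite (eq_bigr (fun=> 'X - x%:P)); last by move=> y /eqP ->.
  by rewrite big_const_seq iter_mulr_1.
apply: (@leq_trans (\sum_(x <- rootsR p) count_mem x s)); last first.
  by apply: leq_sum => x _; exact: mu_ge.
under eq_bigr do rewrite -sum1_count big_mkcond.
rewrite exchange_big /= -sum1_size big_seq [leqRHS]big_seq.
apply: leq_sum => y sy.
have : y \in rootsR p.
  rewrite -(roots_on_rootsR p0) in_itv /= -dvdp_XsubCl.
  by apply: dvdp_trans dvd_p; rewrite dvdp_XsubCl root_prod_XsubC.
by move=> rooty; rewrite (big_rem y) //= eqxx.
Qed.

Theorem mainTheorem3 (R : realType) (r s : nat) (A : 'M[R]_(r + s + s))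
    (hA : A^T = A) :
  (r <= nb_real_roots (det_pencil (Jmx R r s) A))%N.
Proof.
set J := Jmx R r s; pose M := A *m J.
pose toC := real_complex R : {rmorphism R -> R[i]}.
have JJ : J *m J = 1%:M := signature_mx_sqr R (r + s) s.
have pencilE : det_pencil J A = char_poly M * (\det J)%:P.
  rewrite /det_pencil -det_map_mx -det_mulmx; congr (\det _).
  rewrite mulmxBl mul_scalar_mx; congr (_ - _).
  by rewrite -map_mxM -mulmxA JJ mulmx1.
have detJ : \det J != 0.
  by rewrite -unitfE -unitmxE; have [] := mulmx1_unit JJ.
have [zs charC] := closed_field_poly_normal (char_poly (map_mx toC M)).
move: charC; rewrite (monicP (char_poly_monic _)) scale1r => charC.
have MC : map_mx toC M = map_mx toC A *m signature_mx _ (r + s) s.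
  by rewrite map_mxM (map_signature_mx toC).
have hermA : adjmx (map_mx toC A) = map_mx toC A.
  apply/matrixP=> i j; rewrite !mxE conj_Creal ?complex_real //.
  by rewrite -{1}hA mxE.
have nonreal : (count (predC (mem Num.real)) zs <= s + s)%N.
  by apply: count_nonreal_roots hermA _; rewrite -MC.
have size_zs : size zs = (r + s + s)%N.
  by have := size_char_poly (map_mx toC M); rewrite charC size_prod_XsubC => -[].
(* The real roots, brought back from R[i] to R. *)
pose rs := [seq complex.Re z | z <- zs & z \is Num.real].
have size_rs : (r <= size rs)%N.
  rewrite size_map size_filter -(leq_add2r (s + s)) addnA -size_zs.
  by rewrite -(count_predC (mem Num.real)) leq_add2l.
apply: leq_trans size_rs _; apply: dvdp_nb_real_roots.
  by rewrite pencilE mulf_neq0 ?polyC_eq0 // monic_neq0 ?char_poly_monic.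
rewrite pencilE; apply: dvdp_mulr; rewrite -(dvdp_map toC) map_char_poly charC.
apply: dvdp_trans (prod_filter_dvdp _ (mem Num.real)).
rewrite rmorph_prod big_map !big_filter (eq_bigr (fun z => 'X - z%:P)) //.
by move=> z zR; rewrite /= map_polyXsubC /= RRe_real.
Qed.
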